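(* Let $n=2m+1\geq 3$ be an odd integer. An element $(P,a)\in X_n$ is a critical point of $\mu:X_n\to\mathbb{R}$ if and only if $P$ is degenerate.
   Context: $d(u,v)=\arccos(u\cdot v)$ denotes the spherical distance on the unit sphere $S^2\subset\mathbb{R}^3$. Set $$B_n:=\{((u_1,\dots,u_n),a)\in (S^2)^n\times(0,\pi) \mid d(u_i,u_{i+1})=a \text{ for } 1\leq i\leq n-1 \text{ and } d(u_n,u_1)=a\}.$$ $SO(3)$ acts on $B_n$ diagonally on the points $u_i$ and trivially on $a$, and $X_n:=B_n/SO(3)$. For odd $n$, $X_n$ is a smooth manifold of dimension $n-2$ (with $B_n$ regarded as a smooth submanifold of $(S^2)^n\times(0,\pi)$, on which $SO(3)$ acts freely). The smooth function $\mu:X_n\to\mathbb{R}$ is $\mu(P,a)=a$; its level set $\mu^{-1}(a)$ is the space $M_n(a)$ of regular spherical $n$-gons $P=(u_1,\dots,u_n)$ with side-length $a$, modulo $SO(3)$. A polygon $P=(u_1,\dots,u_n)\in M_n(a)$ is called degenerate if all of it lies in a great circle of $S^2$. *)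

(* Defs.v *)
From HB Require Import structures.
From mathcomp Require Import all_boot all_order all_algebra.
From mathcomp Require Import all_classical all_reals all_analysis.

Set Implicit Arguments.
Unset Strict Implicit.
Unset Printing Implicit Defensive.

Import Order.TTheory GRing.Theory Num.Theory.
Import numFieldNormedType.Exports.
Local Open Scope classical_set_scope.
Local Open Scope ring_scope.
Local Open Scope quotient_scope.

Section SphericalPolygons.
Variable R : realType.

(* Not the library norm on 'rV[R]_3, which is the sup norm. *)
Definition dot (u v : 'rV[R]_3) : R := \sum_k u 0 k * v 0 k.

Definition sphere : set 'rV[R]_3 := [set u | dot u u = 1].

Definition sdist (u v : 'rV[R]_3) : R := acos (dot u v).

Definition SO3 : set 'M[R]_3 := [set g | g *m g^T = 1%:M /\ \det g = 1].

(* An n-tuple of points of R^3 is an n x 3 matrix whose rows are the points.  *)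
(* The vertices are numbered from 0 to n-1, and [ordS] is the cyclic          *)
(* successor, so that the last vertex is followed by the first one.           *)
Definition B (n : nat) : set ('M[R]_(n, 3) * R) :=
  [set p | [/\ forall i, sphere (row i p.1),
               0 < p.2 < pi
             & forall i, sdist (row i p.1) (row (ordS i) p.1) = p.2]].
Arguments B : clear implicits.

(* g maps the column vector u^T to g *m u^T, i.e. the row u to u *m g^T. *)
Definition so3_act (n : nat) (g : 'M[R]_3) (p : 'M[R]_(n, 3) * R) :
  'M[R]_(n, 3) * R := (p.1 *m g^T, p.2).

Definition same_orbit (n : nat) : rel (B n) :=
  fun p q => `[< exists2 g, SO3 g & val q = so3_act g (val p) >].

Lemma SO3_1 : SO3 1%:M.
Proof. by split; rewrite ?trmx1 ?mulmx1 ?det1. Qed.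

Lemma SO3_trK g : SO3 g -> g^T *m g = 1%:M.
Proof. by case=> /mulmx1C. Qed.

Lemma SO3_tr g : SO3 g -> SO3 g^T.
Proof. by move=> gS; split; rewrite ?trmxK ?SO3_trK ?det_tr //; case: gS. Qed.

Lemma SO3_mul g h : SO3 g -> SO3 h -> SO3 (g *m h).
Proof.
move=> [g1 dg] [h1 dh]; split; last by rewrite det_mulmx dg dh mulr1.
by rewrite trmx_mul mulmxA -(mulmxA g) h1 mulmx1.
Qed.

Lemma same_orbit_refl n : reflexive (@same_orbit n).
Proof.
move=> p; apply/asboolP; exists 1%:M; first exact: SO3_1.
by rewrite /so3_act trmx1 mulmx1; case: (val p).
Qed.

Lemma same_orbit_sym n : symmetric (@same_orbit n).
Proof.
have imp p q : @same_orbit n p q -> same_orbit q p.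
  move=> /asboolP[g gS e]; apply/asboolP; exists g^T; first exact: SO3_tr.
  by rewrite e /so3_act /= trmxK -mulmxA SO3_trK // mulmx1; case: (val p).
by move=> p q; apply/idP/idP; apply: imp.
Qed.

Lemma same_orbit_trans n : transitive (@same_orbit n).
Proof.
move=> q p r /asboolP[g gS e] /asboolP[h hS f]; apply/asboolP.
exists (h *m g); first exact: SO3_mul.
by rewrite f e /so3_act /= trmx_mul mulmxA.
Qed.

Canonical same_orbit_equiv n :=
  EquivRel (@same_orbit n) (@same_orbit_refl n) (@same_orbit_sym n)
           (@same_orbit_trans n).

Definition X (n : nat) := {eq_quot @same_orbit_equiv n}.

Definition mu (n : nat) (x : X n) : R := (val (repr x)).2.

Definition in_great_circle (n : nat) (P : 'M[R]_(n, 3)) : Prop :=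
  exists2 w : 'rV[R]_3, w != 0 & forall i, dot w (row i P) = 0.

Definition degenerate (n : nat) (x : X n) : Prop :=
  in_great_circle (val (repr x)).1.

Lemma same_orbitP n (p q : B n) :
  reflect (\pi_(X n) p = \pi_(X n) q) (same_orbit p q).
Proof. exact/eqquotP. Qed.

Lemma mu_pi n (p : B n) : mu (\pi_(X n) p) = (val p).2.
Proof.
have /same_orbitP/asboolP[g _ ->] // : \pi_(X n) (repr (\pi_(X n) p)) = \pi p.
by rewrite reprK.
Qed.

Lemma dot_act g u v : dot u (v *m g) = dot (u *m g^T) v.
Proof.
have dotE a b : dot a b = (a *m b^T) 0 0.
  by rewrite /dot mxE; apply: eq_bigr => k _; rewrite mxE.
by rewrite !dotE trmx_mul mulmxA.
Qed.

Lemma in_great_circle_act n g (P : 'M[R]_(n, 3)) :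
  SO3 g -> in_great_circle P -> in_great_circle (P *m g^T).
Proof.
move=> gS [w w0 wP]; exists (w *m g^T) => [|i].
  apply: contraNneq w0 => e.
  by rewrite -(mulmx1 w) -(SO3_trK gS) mulmxA e mul0mx.
by rewrite row_mul dot_act trmxK -mulmxA SO3_trK // mulmx1.
Qed.

Lemma degenerate_pi n (p : B n) :
  degenerate (\pi_(X n) p) <-> in_great_circle (val p).1.
Proof.
have imp (q r : B n) : same_orbit q r ->
    in_great_circle (val q).1 -> in_great_circle (val r).1.
  by move=> /asboolP[g gS ->] /=; apply: in_great_circle_act.
have e : same_orbit (repr (\pi_(X n) p)) p by apply/same_orbitP; rewrite reprK.
by split; apply: imp => //; rewrite same_orbit_sym.
Qed.

Definition smooth_near (f : R -> R) (t0 : R) : Prop :=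
  \forall t \near t0, forall k, derivable (derive1n k f) t 1.

(* As B n is a submanifold of (R^3)^n x R, smoothness of a curve in it is     *)
(* smoothness of the coordinates in the ambient space.                        *)
Definition smooth_curve_B (n : nat) (c : R -> B n) (t0 : R) : Prop :=
  (forall i k, smooth_near (fun t => (val (c t)).1 i k) t0) /\
  smooth_near (fun t => (val (c t)).2) t0.

(* For n odd, SO(3) acts freely on B n and the smooth structure of X n is the *)
(* one for which B n -> X n is a submersion (a principal SO(3)-bundle); hence *)
(* the smooth curves in X n are those which locally lift to smooth curves in  *)
(* B n.                                                                       *)
Definition smooth_curve_X (n : nat) (gamma : R -> X n) (t0 : R) : Prop :=
  exists2 c : R -> B n, smooth_curve_B c t0
    & \forall t \near t0, gamma t = \pi_(X n) (c t).

(* The differential of f at x vanishes: tangent vectors at x are the          *)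
(* velocities gamma'(0) of the smooth curves with gamma(0) = x, and df_x maps *)
(* gamma'(0) to (f \o gamma)'(0).                                             *)
Definition critical_point (n : nat) (f : X n -> R) (x : X n) : Prop :=
  forall gamma : R -> X n, smooth_curve_X gamma 0 -> gamma 0 = x ->
    is_derive (0 : R) (1 : R) (f \o gamma) (0 : R).

End SphericalPolygons.
Arguments B : clear implicits.

(* Main.v *)
(* If P lies on the great circle orthogonal to w, the tangential speeds tau_i *)
(* of the vertices satisfy tau_(i+1) - tau_i = e_i a', where e_i = +1 or -1   *)
(* gives the direction of the i-th edge along the circle. Summing over the    *)
(* cycle yields a' \sum_i e_i = 0, and a sum of an odd number of signs is not *)
(* 0, so a' = 0.                                                              *)
(* If P is not degenerate, some three consecutive vertices p, v, q are        *)
(* linearly independent. Opening every hinge of the chain going from q to p   *)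
(* the long way by the angle t gives it edges of length a + t. As v is the    *)
(* apex of a nondegenerate isosceles triangle over p and q, for t near 0      *)
(* there remains an apex at distance a + t from both ends, given by an        *)
(* explicit formula smooth in t. Along this curve mu = a + t has derivative 1.*)

Require Import Defs.
From mathcomp Require Import all_boot all_order all_algebra.
From mathcomp Require Import all_classical all_reals all_analysis.
From mathcomp Require Import zify ring lra.

Set Implicit Arguments.
Unset Strict Implicit.
Unset Printing Implicit Defensive.

Import Order.TTheory GRing.Theory Num.Theory.
Import numFieldNormedType.Exports.
Local Open Scope classical_set_scope.
Local Open Scope ring_scope.
Local Open Scope quotient_scope.

(** Criticality is tested along curves in [B]. At a degenerate polygon only first-order data matter:
    differentiating [u_i . u_i = 1] and [u_i . u_(i+1) = cos a] gives the linear relations of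
    [great_circle_stationary], whose sum over the cycle telescopes, and [odd_sum_sign_neq0] then
    forces [a' = 0]. At a nondegenerate polygon one curve with [a' = 1] is enough.
    [coplanar_of_triples] yields a vertex independent of its two neighbours; [dot_bentS] lengthens
    every edge not meeting that vertex, and [apexl], [apexr], [apex_unit] put the vertex back.
    Independence makes the height of the apex nonzero, so the square root defining it is smooth near
    [t = 0]; [exists_deformation] collects the result. *)

(** * Smooth functions on an open set *)

Section SmoothFunctions.
Variables (R : realType) (U : set R).
Hypothesis oU : open U.
Implicit Types (f g : R -> R) (k : nat) (t : R).

(** Smoothness is treated one order at a time, with the first derivative peeled off, so that closure
    properties follow by induction on [k]. *)
Fixpoint differentiable_upto k f : Prop :=
  if k is k'.+1 then
    (forall t, U t -> derivable f t 1) /\ differentiable_upto k' (derive1 f)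
  else True.

Definition smooth_on f := forall k, differentiable_upto k f.

Lemma near_open t (P : R -> Prop) :
  U t -> (forall t, U t -> P t) -> \forall s \near t, P s.
Proof. by move=> Ut UP; apply: filterS UP _; exact: open_nbhs_nbhs. Qed.

Lemma eq_differentiable_upto k f g :
  (forall t, U t -> f t = g t) ->
  differentiable_upto k f -> differentiable_upto k g.
Proof.
elim: k f g => //= k IH f g fg [df Df]; split=> [t Ut|].
  apply: near_eq_derivable (df t Ut); exact: near_open.
apply: IH Df => t Ut; rewrite !derive1E; apply: near_eq_derive.
exact: near_open.
Qed.

Lemma differentiable_uptoW k f :
  differentiable_upto k.+1 f -> differentiable_upto k f.
Proof.
elim: k f => // k IH f /= [df D2]; split=> //.
exact: IH D2.
Qed.

Lemma differentiable_upto_derivable k f t :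
  differentiable_upto k.+1 f -> U t -> derivable f t 1.
Proof. by case=> df _; exact: df. Qed.

(** An explicit derivative is known only on [U]; as [U] is open, it may still replace [derive1 f] at
    all higher orders. Each closure property below uses this. *)
Lemma differentiable_upto_is_derive k f f' :
  (forall t, U t -> is_derive t (1 : R) f (f' t)) -> differentiable_upto k f' ->
  differentiable_upto k.+1 f.
Proof.
move=> df Df; split=> [t Ut|]; first by case: (df t Ut).
apply: eq_differentiable_upto Df => t Ut.
by rewrite derive1E; case: (df t Ut) => _ ->.
Qed.

Lemma is_derive_derive1 f t : derivable f t 1 -> is_derive t (1 : R) f (derive1 f t).
Proof. by move=> df; rewrite derive1E; apply/derivableP. Qed.

Lemma smooth_onP f k t : smooth_on f -> U t -> derivable (derive1n k f) t 1.
Proof.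
move=> Sf Ut; have {Sf} := Sf k.+1.
elim: k f => [|k IH] f; first by case=> df _; exact: df.
by case=> _ /IH; rewrite derive1Sn.
Qed.

Lemma smooth_on_derivable f t : smooth_on f -> U t -> derivable f t 1.
Proof. exact: (@smooth_onP f 0). Qed.

Lemma eq_smooth_on f g :
  (forall t, U t -> f t = g t) -> smooth_on f -> smooth_on g.
Proof. by move=> fg Sf k; apply: eq_differentiable_upto (Sf k). Qed.

Lemma smooth_on_cst (a : R) : smooth_on (fun=> a).
Proof.
move=> k; elim: k a => // k IH a.
by apply: (differentiable_upto_is_derive (f' := fun=> 0)) => // t _.
Qed.

Lemma smooth_on_id : smooth_on id.
Proof.
case=> // k; apply: (differentiable_upto_is_derive (f' := fun=> 1)) => //.
exact: smooth_on_cst.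
Qed.

Lemma differentiable_uptoD k f g : differentiable_upto k f ->
  differentiable_upto k g -> differentiable_upto k (fun t => f t + g t).
Proof.
elim: k f g => // k IH f g [df Df] [dg Dg].
apply: (differentiable_upto_is_derive (f' := fun t => derive1 f t + derive1 g t)).
  move=> t Ut.
  have ? := is_derive_derive1 (df t Ut); have ? := is_derive_derive1 (dg t Ut).
  exact: is_deriveD.
exact: IH.
Qed.

Lemma differentiable_uptoM k f g : differentiable_upto k f ->
  differentiable_upto k g -> differentiable_upto k (fun t => f t * g t).
Proof.
elim: k f g => // k IH f g Df Dg.
apply: (differentiable_upto_is_derive
  (f' := fun t => f t * derive1 g t + g t * derive1 f t)).
  move=> t Ut.
  have ? := is_derive_derive1 (differentiable_upto_derivable Df Ut).
  have ? := is_derive_derive1 (differentiable_upto_derivable Dg Ut).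
  exact: is_deriveM.
by apply: differentiable_uptoD; apply: IH;
  [exact: differentiable_uptoW | case: Dg
  |exact: differentiable_uptoW | case: Df].
Qed.

(** The derivative is a product in which the inverse of [f] recurs, but now only to order [k], where
    the induction hypothesis applies. *)
Lemma differentiable_uptoV k f : (forall t, U t -> f t != 0) ->
  differentiable_upto k f -> differentiable_upto k (fun t => (f t)^-1).
Proof.
move=> f0; elim: k => // k IH Df.
apply: (differentiable_upto_is_derive
  (f' := fun t => (- 1 * ((f t)^-1 * (f t)^-1)) * derive1 f t)).
  move=> t Ut.
  have ? := is_derive_derive1 (differentiable_upto_derivable Df Ut).
  apply: is_derive_eq; first by apply: is_deriveV; exact: f0.
  by rewrite -exprVn expr2 mulN1r.
have DV := IH (differentiable_uptoW Df).
apply: differentiable_uptoM; last by case: Df.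
by apply: differentiable_uptoM; [exact: smooth_on_cst | exact: differentiable_uptoM].
Qed.

Lemma smooth_onD f g :
  smooth_on f -> smooth_on g -> smooth_on (fun t => f t + g t).
Proof. by move=> Sf Sg k; exact: differentiable_uptoD. Qed.

Lemma smooth_onM f g :
  smooth_on f -> smooth_on g -> smooth_on (fun t => f t * g t).
Proof. by move=> Sf Sg k; exact: differentiable_uptoM. Qed.

Lemma smooth_onN f : smooth_on f -> smooth_on (fun t => - f t).
Proof.
move=> Sf; apply: (@eq_smooth_on (fun t => - 1 * f t)) => [t _|].
  by rewrite mulN1r.
by apply: smooth_onM => //; exact: smooth_on_cst.
Qed.

Lemma smooth_onB f g :
  smooth_on f -> smooth_on g -> smooth_on (fun t => f t - g t).
Proof. by move=> Sf Sg; apply: smooth_onD => //; exact: smooth_onN. Qed.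

Lemma smooth_onV f : (forall t, U t -> f t != 0) ->
  smooth_on f -> smooth_on (fun t => (f t)^-1).
Proof. by move=> f0 Sf k; exact: differentiable_uptoV. Qed.

Lemma smooth_on_sqrt f : (forall t, U t -> 0 < f t) ->
  smooth_on f -> smooth_on (fun t => Num.sqrt (f t)).
Proof.
move=> f0 Sf; elim=> // k IH.
apply: (differentiable_upto_is_derive
  (f' := fun t => (2 * Num.sqrt (f t))^-1 * derive1 f t)).
  move=> t Ut; have ? := is_derive_derive1 (smooth_on_derivable Sf Ut).
  have ? := is_derive1_sqrt (f0 t Ut).
  exact: is_derive1_comp.
apply: differentiable_uptoM; last by case: (Sf k.+1).
apply: differentiable_uptoV => [t Ut|].
  by rewrite mulf_neq0 ?pnatr_eq0 // sqrtr_eq0 -ltNge f0.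
by apply: differentiable_uptoM => //; exact: smooth_on_cst.
Qed.

Lemma smooth_on_cos_sin : smooth_on cos /\ smooth_on sin.
Proof.
suff CS k : differentiable_upto k (@cos R) /\ differentiable_upto k (@sin R).
  by split=> k; case: (CS k).
elim: k => // k [Dc Ds]; split; last first.
  exact: (differentiable_upto_is_derive (f' := cos)).
apply: (differentiable_upto_is_derive (f' := fun t => - 1 * sin t)).
  by move=> t _; rewrite mulN1r; exact: is_derive_cos.
by apply: differentiable_uptoM => //; exact: smooth_on_cst.
Qed.

Lemma smooth_on_near f t : smooth_on f -> U t -> smooth_near f t.
Proof. by move=> Sf Ut; apply: near_open => // s Us k; exact: smooth_onP. Qed.

End SmoothFunctions.

(** * Vector algebra in R^3: cross products, Gram determinants, rotations *)

Section Vectors.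
Variable R : realType.
Implicit Types (u v w x y p q : 'rV[R]_3) (i k : 'I_3).

Definition cross u v : 'rV[R]_3 :=
  \row_k (u 0 (k + 1) * v 0 (k + 2) - u 0 (k + 2) * v 0 (k + 1)).

Definition triple u v w := dot (cross u v) w.

Lemma dotE u v : dot u v = u 0 0 * v 0 0 + u 0 1 * v 0 1 + u 0 2 * v 0 2.
Proof.
rewrite /dot !big_ord_recr big_ord0 /= add0r.
by congr (u 0 _ * v 0 _ + u 0 _ * v 0 _ + u 0 _ * v 0 _); exact: val_inj.
Qed.

Lemma crossE u v :
  (cross u v 0 0 = u 0 1 * v 0 2 - u 0 2 * v 0 1) *
  (cross u v 0 1 = u 0 2 * v 0 0 - u 0 0 * v 0 2) *
  (cross u v 0 2 = u 0 0 * v 0 1 - u 0 1 * v 0 0).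
Proof.
by split; [split|]; rewrite mxE;
  congr (u 0 _ * v 0 _ - u 0 _ * v 0 _); exact: val_inj.
Qed.

Lemma rowD u v k : (u + v) 0 k = u 0 k + v 0 k.
Proof. by rewrite mxE. Qed.

Lemma rowZ (a : R) u k : (a *: u) 0 k = a * u 0 k.
Proof. by rewrite mxE. Qed.

Lemma row3P u v : u 0 0 = v 0 0 -> u 0 1 = v 0 1 -> u 0 2 = v 0 2 -> u = v.
Proof.
move=> e0 e1 e2; apply/rowP => -[[|[|[|//]]] lt3].
- by rewrite [Ordinal _](_ : _ = 0) //; exact: val_inj.
- by rewrite [Ordinal _](_ : _ = 1) //; exact: val_inj.
- by rewrite [Ordinal _](_ : _ = 2) //; exact: val_inj.
Qed.

Lemma dotC u v : dot u v = dot v u.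
Proof. by rewrite !dotE; ring. Qed.

Lemma dotDr u v w : dot u (v + w) = dot u v + dot u w.
Proof. by rewrite !dotE !mxE; ring. Qed.

Lemma dotZr (a : R) u v : dot u (a *: v) = a * dot u v.
Proof. by rewrite !dotE !mxE; ring. Qed.

Lemma dotDl u v w : dot (u + v) w = dot u w + dot v w.
Proof. by rewrite dotC dotDr !(dotC w). Qed.

Lemma dotZl (a : R) u v : dot (a *: u) v = a * dot u v.
Proof. by rewrite dotC dotZr dotC. Qed.

Lemma dot_ge0 u : 0 <= dot u u.
Proof. by apply: sumr_ge0 => k _; rewrite -expr2 sqr_ge0. Qed.

Lemma dot_eq0 u : (dot u u == 0) = (u == 0).
Proof.
apply/idP/idP => [|/eqP->]; last by rewrite /dot big1 // => k _; rewrite mxE mul0r.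
rewrite /dot psumr_eq0 => [/allP u0|k _]; last by rewrite -expr2 sqr_ge0.
apply/eqP/rowP => k; rewrite mxE; apply/eqP.
by have := u0 k (mem_index_enum _); rewrite mulf_eq0 orbb.
Qed.

Lemma dot_gt0 u : u != 0 -> 0 < dot u u.
Proof. by rewrite lt_def dot_ge0 dot_eq0 andbT. Qed.

Lemma dot_crossl u v : dot u (cross u v) = 0.
Proof. by rewrite !dotE !crossE; ring. Qed.

Lemma dot_crossr u v : dot v (cross u v) = 0.
Proof. by rewrite !dotE !crossE; ring. Qed.

Lemma dot_cross u v :
  dot (cross u v) (cross u v) = dot u u * dot v v - dot u v ^+ 2.
Proof. by rewrite !dotE !crossE; ring. Qed.

(** The right-hand side is the Gram determinant of [u], [v], [w]. *)
Lemma triple_sqr u v w : triple u v w ^+ 2 =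
  dot u u * dot v v * dot w w + 2 * (dot u v * dot v w * dot u w)
  - dot u u * dot v w ^+ 2 - dot v v * dot u w ^+ 2 - dot w w * dot u v ^+ 2.
Proof. by rewrite /triple !dotE !crossE; ring. Qed.

(** Coordinates of [v] in the basis [p], [q], [cross p q], with the denominator cleared. *)
Lemma cross_basis p q v : dot (cross p q) (cross p q) *: v =
  (dot v p * dot q q - dot v q * dot p q) *: p +
  (dot v q * dot p p - dot v p * dot p q) *: q + triple p q v *: cross p q.
Proof. by apply: row3P; rewrite /triple !(rowD, rowZ) !dotE !crossE; ring. Qed.

Lemma dot_le1 u v : dot u u = 1 -> dot v v = 1 -> -1 <= dot u v <= 1.
Proof.
move=> u1 v1; have := dot_ge0 (cross u v).
by rewrite dot_cross u1 v1 => ?; apply/andP; split; nra.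
Qed.

(* Rodrigues' formula, c and s being the cosine and sine of the angle. *)
Definition rot u (c s : R) x := c *: x + s *: cross u x + ((1 - c) * dot u x) *: u.

Lemma dot_rot u (c s : R) x y : dot u u = 1 -> c ^+ 2 + s ^+ 2 = 1 ->
  dot (rot u c s x) (rot u c s y) = dot x y.
Proof.
move=> u1 cs1.
have xc a b : dot (cross u a) b = - dot a (cross u b).
  by rewrite !dotE !crossE; ring.
have cc : dot (cross u x) (cross u y) = dot x y - dot u x * dot u y.
  by rewrite -[dot x y]mul1r -u1 !dotE !crossE; ring.
have xu : dot (cross u x) u = 0 by rewrite dotC dot_crossl.
rewrite /rot !(dotDl, dotDr, dotZl, dotZr) cc u1 dot_crossl xu xc (dotC x u).
transitivity ((c ^+ 2 + s ^+ 2) * dot x y +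
  (1 - (c ^+ 2 + s ^+ 2)) * (dot u x * dot u y)); first by ring.
by rewrite cs1; ring.
Qed.

Lemma rot1 u x : rot u 1 0 x = x.
Proof. by rewrite /rot subrr mul0r !scale0r !addr0 scale1r. Qed.

(** The axis is the unit normal to the plane of [u] and [v], so the rotation moves [v] along their
    common great circle, away from [u]. *)
Lemma dot_rot_cross u v (a t : R) : dot u u = 1 -> dot v v = 1 ->
  dot u v = cos a -> sin a != 0 ->
  dot u (rot ((sin a)^-1 *: cross u v) (cos t) (sin t) v) = cos (a + t).
Proof.
move=> u1 v1 uv sa0.
have -> : dot u (rot ((sin a)^-1 *: cross u v) (cos t) (sin t) v) =
    cos t * dot u v + sin t / sin a * (dot u v ^+ 2 - dot u u * dot v v).
  by rewrite /rot !dotE !(rowD, rowZ, crossE); field.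
rewrite uv u1 v1 mulr1 cosD (cos2sin2 a).
by field.
Qed.

End Vectors.

(** * Degenerate polygons are critical points *)

Section DegenerateIsCritical.
Variable R : realType.

Lemma is_derive_dot (u v : R -> 'rV[R]_3) (u' v' : 'rV[R]_3) (t : R) :
  (forall k, is_derive t (1 : R) (fun s => u s 0 k) (u' 0 k)) ->
  (forall k, is_derive t (1 : R) (fun s => v s 0 k) (v' 0 k)) ->
  is_derive t (1 : R) (fun s => dot (u s) (v s)) (dot u' (v t) + dot (u t) v').
Proof.
move=> du dv.
have -> : (fun s => dot (u s) (v s)) =
    \sum_(k < 3) ((fun s => u s 0 k) * (fun s => v s 0 k)).
  by apply/funext => s; rewrite /dot fct_sumE.
have dk k : is_derive t (1 : R) ((fun s => u s 0 k) * (fun s => v s 0 k))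
    (u' 0 k * v t 0 k + u t 0 k * v' 0 k).
  have ? := du k; have ? := dv k.
  by apply: is_derive_eq; rewrite /GRing.scale /= addrC mulrC.
by apply: is_derive_eq; rewrite big_split.
Qed.

(** Each [D i] is [d] or [- d], so the sum is [d * (2 r - n)], where [r] counts the indices with
    [D i = d]; and [2 r] is even. *)
Lemma odd_sum_sign_neq0 (n : nat) (d : R) (D : 'I_n -> R) : odd n -> d != 0 ->
  (forall i, D i ^+ 2 = d ^+ 2) -> \sum_i D i != 0.
Proof.
move=> oddn d0 Dd.
have DE i : D i = d * (((D i == d) * 2)%N%:R - 1).
  have /eqP := Dd i; rewrite eqf_sqr => /orP[/eqP->|/eqP->].
    by rewrite eqxx mul1n; ring.
  have /negPf -> : - d != d by rewrite eqNr.
  by rewrite mul0n; ring.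
rewrite (eq_bigr _ (fun i _ => DE i)) -mulr_sumr mulf_neq0 // sumrB.
rewrite -natr_sum sumr_const card_ord subr_eq0 eqr_nat.
apply: contraTneq oddn => <-.
by rewrite -big_distrl /= muln2 odd_double.
Qed.

(** The rows of [U'] are the velocities of the vertices. The normal [w] is not normalised: the edge
    direction [D i] is plus or minus [sqrt N * sin a], and [tau i] is the tangential speed times
    [sqrt N]. *)
Lemma great_circle_stationary (n : nat) (U U' : 'M[R]_(n, 3)) (w : 'rV[R]_3)
    (a a' : R) : odd n -> w != 0 -> sin a != 0 ->
  (forall i, dot w (row i U) = 0) ->
  (forall i, dot (row i U) (row i U) = 1) ->
  (forall i, dot (row i U) (row (ordS i) U) = cos a) ->
  (forall i, dot (row i U') (row i U) = 0) ->
  (forall i, dot (row i U') (row (ordS i) U) +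
             dot (row i U) (row (ordS i) U') = - sin a * a') ->
  a' = 0.
Proof.
move=> oddn w0 sa0 wU U1 Ua dU1 dUa.
have N0 := dot_gt0 w0; set N := dot w w in N0.
pose D i := triple w (row i U) (row (ordS i) U).
pose tau i := dot (row i U') (cross w (row i U)).
have Uw i : dot (row i U) w = 0 by rewrite dotC wU.
have D2 i : D i ^+ 2 = (Num.sqrt N * sin a) ^+ 2.
  rewrite /D triple_sqr !U1 !wU Ua -/N exprMn sqr_sqrtr ?ltW// sin2cos2.
  by ring.
have ww i : dot (cross w (row i U)) (cross w (row i U)) = N.
  by rewrite dot_cross U1 wU expr0n subr0 mulr1.
(* Expand the next vertex in the orthogonal basis [w], [u_i], [w x u_i]: its [w]-coordinate is 0,
   and the [u_i]-term drops out because the velocity is orthogonal to [u_i]. *)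
have next i : N * dot (row i U') (row (ordS i) U) = D i * tau i.
  rewrite -dotZr -{1}(ww i) cross_basis !Uw !wU.
  by rewrite !(dotDr, dotZr) dU1 /D /tau; ring.
have prev i :
    N * dot (row i U) (row (ordS i) U') = - (D i * tau (ordS i)).
  rewrite [dot _ _]dotC -dotZr -{1}(ww (ordS i)) cross_basis !Uw !wU.
  have -> : triple w (row (ordS i) U) (row i U) = - D i.
    by rewrite /D /triple !dotE !crossE; ring.
  by rewrite !(dotDr, dotZr) dU1 /tau; ring.
have step i : sin a * (tau (ordS i) - tau i) = a' * D i.
  have Nsa0 : N * sin a != 0 by rewrite mulf_neq0 // gt_eqF.
  apply: (mulfI Nsa0).
  have D2' : D i * D i = N * sin a * sin a.
    by rewrite -expr2 D2 exprMn sqr_sqrtr ?ltW// expr2 mulrA.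
  transitivity (D i * (D i * (tau (ordS i) - tau i))).
    by rewrite [RHS]mulrA D2' mulrA.
  have -> : D i * (tau (ordS i) - tau i) = N * sin a * a'.
    have := congr1 (fun z => N * z) (dUa i).
    by rewrite mulrDr next prev => e; lra.
  by ring.
(* [ordS] permutes the indices, so the differences of [tau] sum to 0. *)
have : a' * \sum_i D i = 0.
  rewrite mulr_sumr -(eq_bigr _ (fun i _ => step i)) -mulr_sumr sumrB.
  by rewrite [X in _ - X](reindex_inj (@ordS_inj n)) subrr mulr0.
move/eqP; rewrite mulf_eq0 => /orP[/eqP //|].
have d0 : Num.sqrt N * sin a != 0 by rewrite mulf_neq0 // sqrtr_eq0 -ltNge.
by move/negPf: (odd_sum_sign_neq0 oddn d0 D2) => ->.
Qed.

Lemma cos_sdist (u v : 'rV[R]_3) : dot u u = 1 -> dot v v = 1 ->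
  cos (sdist u v) = dot u v.
Proof. by move=> u1 v1; rewrite acosK // in_itv /= dot_le1. Qed.

Lemma degenerate_critical_point (n : nat) (x : X R n) : odd n ->
  degenerate x -> critical_point (@mu R n) x.
Proof.
move=> oddn xdeg gamma [c [cP ca] gammac] gamma0.
pose P t := (val (c t)).1; pose a t := (val (c t)).2.
have PB t : B R n (P t, a t).
  by have := set_valP (c t); rewrite /P /a; case: (val (c t)).
have P1 t i : dot (row i (P t)) (row i (P t)) = 1 by case: (PB t) => + _ _; apply.
have Pa t i : dot (row i (P t)) (row (ordS i) (P t)) = cos (a t).
  by case: (PB t) => _ _ /(_ i) /= <-; rewrite cos_sdist.
(* Degeneracy of [x] concerns its chosen representative; [c 0] may be another point of the same
   orbit. *)
have [w w0 wP] : in_great_circle (P 0).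
  by move: xdeg; rewrite -gamma0 (nbhs_singleton gammac) degenerate_pi.
have da : derivable a 0 1 := nbhs_singleton ca 0%N.
have dP i k : derivable (fun t => P t i k) 0 1 := nbhs_singleton (cP i k) 0%N.
pose P' : 'M[R]_(n, 3) := \matrix_(i, k) derive1 (fun t => P t i k) 0.
have dPr i k : is_derive (0 : R) (1 : R) (fun t => row i (P t) 0 k)
    (row i P' 0 k).
  have -> : (fun t => row i (P t) 0 k) = (fun t => P t i k).
    by apply/funext => t; rewrite mxE.
  by rewrite !mxE; exact: is_derive_derive1.
have dcos : is_derive (0 : R) (1 : R) (cos \o a) (- sin (a 0) * derive1 a 0).
  apply: is_derive1_comp; exact: is_derive_derive1.
have a'0 : derive1 a 0 = 0.
  apply: (great_circle_stationary (U := P 0) (U' := P') (w := w) (a := a 0)) => //.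
  - by rewrite gt_eqF // sin_gt0_pi //; case: (PB 0).
  - move=> i; have := is_derive_dot (dPr i) (dPr i).
    rewrite (_ : (fun _ => _) = cst 1); last by apply/funext => t; rewrite P1.
    move=> /@derive_val; rewrite derive_cst => /esym.
    by rewrite [dot (row i (P 0)) _]dotC -mulr2n => /eqP; rewrite mulrn_eq0 => /eqP.
  - move=> i; have := is_derive_dot (dPr i) (dPr (ordS i)).
    rewrite (_ : (fun _ => _) = cos \o a); last by apply/funext => t; rewrite Pa.
    by move=> /@derive_val <-; exact: (@derive_val _ _ _ _ _ _ _ dcos).
apply: (near_eq_is_derive (f := a)); last first.
  by have := is_derive_derive1 da; rewrite a'0.
by apply: filterS gammac => t gt; rewrite /= gt mu_pi.
Qed.

End DegenerateIsCritical.

(** * Smooth curves of vectors *)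

Section SmoothRows.
Variables (R : realType) (U : set R).
Hypothesis oU : open U.
Implicit Types (f : R -> R) (x y : R -> 'rV[R]_3).

Definition smooth_row x := forall k, smooth_on U (fun t => x t 0 k).

Lemma smooth_row_cst (v : 'rV[R]_3) : smooth_row (fun=> v).
Proof. by move=> k; exact: smooth_on_cst. Qed.

Lemma smooth_rowD x y :
  smooth_row x -> smooth_row y -> smooth_row (fun t => x t + y t).
Proof.
move=> Sx Sy k; under eq_fun do rewrite mxE.
exact: smooth_onD.
Qed.

Lemma smooth_rowZ f x :
  smooth_on U f -> smooth_row x -> smooth_row (fun t => f t *: x t).
Proof.
move=> Sf Sx k; under eq_fun do rewrite mxE.
exact: smooth_onM.
Qed.

Lemma smooth_row_cross x y :
  smooth_row x -> smooth_row y -> smooth_row (fun t => cross (x t) (y t)).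
Proof.
move=> Sx Sy k; under eq_fun do rewrite mxE.
by apply: smooth_onB => //; exact: smooth_onM.
Qed.

Lemma smooth_on_dot x y :
  smooth_row x -> smooth_row y -> smooth_on U (fun t => dot (x t) (y t)).
Proof.
move=> Sx Sy; under eq_fun do rewrite dotE.
by do 2?[apply: smooth_onD => //]; exact: smooth_onM.
Qed.

Lemma smooth_row_rot (v : 'rV[R]_3) x :
  smooth_row x -> smooth_row (fun t => rot v (cos t) (sin t) (x t)).
Proof.
move=> Sx; have [Sc Ss] := smooth_on_cos_sin oU.
have Sv := smooth_row_cst v.
apply: smooth_rowD; first apply: smooth_rowD.
- exact: smooth_rowZ.
- by apply: smooth_rowZ => //; exact: smooth_row_cross.
apply: smooth_rowZ => //; apply: smooth_onM => //; last exact: smooth_on_dot.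
by apply: smooth_onB => //; exact: smooth_on_cst.
Qed.

Lemma smooth_on_cos_shift (a : R) : smooth_on U (fun t => cos (a + t)).
Proof.
have [Sc Ss] := smooth_on_cos_sin oU.
under eq_fun do rewrite cosD.
by apply: smooth_onB => //; apply: smooth_onM => //; exact: smooth_on_cst.
Qed.

End SmoothRows.

Lemma open_smooth_gt0 (R : realType) (f : R -> R) :
  smooth_on setT f -> open [set t | 0 < f t].
Proof.
move=> Sf; apply: (@open_comp _ _ f [set x | 0 < x]); last exact: open_gt.
move=> t _; apply: differentiable_continuous; apply/derivable1_diffP.
exact: smooth_on_derivable.
Qed.

(** * Opening a chain of edges by the angle t *)

Section Bending.
Variables (R : realType) (V : nat -> 'rV[R]_3) (a : R).
Hypothesis V1 : forall j, dot (V j) (V j) = 1.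
Hypothesis Va : forall j, dot (V j) (V j.+1) = cos a.
Hypothesis sa0 : sin a != 0.

Definition hinge j t := rot ((sin a)^-1 *: cross (V j) (V j.+1)) (cos t) (sin t).

(* Opening the line at a hinge moves all of the part beyond it rigidly, hence *)
(* the composition of rotations.                                              *)
Fixpoint bend j t x := if j is i.+1 then bend i t (hinge i t x) else x.

Definition bent j t := bend j t (V j).

Lemma hinge_axis j : dot ((sin a)^-1 *: cross (V j) (V j.+1))
  ((sin a)^-1 *: cross (V j) (V j.+1)) = 1.
Proof.
rewrite dotZl dotZr dot_cross !V1 Va cos2sin2.
by field.
Qed.

Lemma dot_bend j t x y : dot (bend j t x) (bend j t y) = dot x y.
Proof.
elim: j x y => //= j IH x y.
by rewrite IH dot_rot ?hinge_axis ?cos2Dsin2.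
Qed.

Lemma bent_unit j t : dot (bent j t) (bent j t) = 1.
Proof. by rewrite dot_bend. Qed.

(** Both points are images under the isometry [bend j t]: of [V j], and of [V j.+1] turned away from
    it by [t]. *)
Lemma dot_bentS j t : dot (bent j t) (bent j.+1 t) = cos (a + t).
Proof. by rewrite /bent /= dot_bend /hinge dot_rot_cross. Qed.

Lemma bent0 j : bent j 0 = V j.
Proof.
suff bend0 x : bend j 0 x = x by exact: bend0.
by elim: j x => //= j IH x; rewrite IH /hinge cos0 sin0 rot1.
Qed.

Lemma smooth_row_bend (U : set R) j (x : R -> 'rV[R]_3) : open U ->
  smooth_row U x -> smooth_row U (fun t => bend j t (x t)).
Proof.
by move=> oU; elim: j x => //= j IH x Sx; apply: IH; exact: smooth_row_rot.
Qed.

Lemma smooth_row_bent (U : set R) j : open U -> smooth_row U (bent j).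
Proof. by move=> oU; apply: smooth_row_bend => //; exact: smooth_row_cst. Qed.

End Bending.

(** * The apex of an isosceles spherical triangle *)

Section Apex.
Variable R : realType.
Implicit Types (p q v : 'rV[R]_3) (c g : R).

(** For independent unit vectors [p], [q], the points whose dot products with both equal [c] form a
    line, parametrised by [g]. *)
Definition apex p q c g := (c / (1 + dot p q)) *: (p + q) + g *: cross p q.

Lemma apexl p q c g : dot p p = 1 -> 1 + dot p q != 0 ->
  dot p (apex p q c g) = c.
Proof.
by move=> p1 ?; rewrite /apex !(dotDr, dotZr) p1 dot_crossl; field.
Qed.

Lemma apexr p q c g : dot q q = 1 -> 1 + dot p q != 0 ->
  dot q (apex p q c g) = c.
Proof.
move=> q1 ?; rewrite /apex !(dotDr, dotZr) q1 dot_crossr (dotC q).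
by field.
Qed.

(* The square of the coefficient of p x q in a unit vector at spherical       *)
(* distance arccos c from both p and q, where k = p . q.                      *)
Definition height2 (k c : R) := (1 + k - 2 * c ^+ 2) / ((1 + k) * (1 - k ^+ 2)).

Lemma apex_unit p q c g : dot p p = 1 -> dot q q = 1 ->
  1 + dot p q != 0 -> 1 - dot p q ^+ 2 != 0 ->
  g ^+ 2 = height2 (dot p q) c -> dot (apex p q c g) (apex p q c g) = 1.
Proof.
move=> p1 q1 k1 k2 g2; rewrite {1}/apex !(dotDl, dotZl) apexl // apexr //.
have -> : dot (cross p q) (apex p q c g) = g * (1 - dot p q ^+ 2).
  rewrite /apex !(dotDr, dotZr) !(dotC (cross p q)) dot_crossl dot_crossr.
  by rewrite dot_cross p1 q1; ring.
by rewrite mulrA -expr2 g2 /height2; field; rewrite k1 k2.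
Qed.

Lemma apexE p q v c : dot p p = 1 -> dot q q = 1 -> dot p v = c ->
  dot q v = c -> 1 - dot p q ^+ 2 != 0 ->
  v = apex p q c (triple p q v / (1 - dot p q ^+ 2)).
Proof.
move=> p1 q1 pv qv k2.
have k1 : 1 + dot p q != 0.
  by apply: contraNneq k2 => e; apply/eqP; rewrite -(subr0 0) -{1}e; nra.
apply: (scalerI k2); rewrite -{1}(mulr1 1) -{1}p1 -{1}q1 -dot_cross cross_basis.
rewrite !(dotC v) pv qv p1 q1 /apex !(scalerDr, scalerA).
congr (_ *: _ + _ *: _ + _ *: _); field => //; by rewrite k1.
Qed.

Lemma triple_sqr_isosceles p q v c : dot p p = 1 -> dot q q = 1 ->
  dot v v = 1 -> dot p v = c -> dot q v = c ->
  triple p q v ^+ 2 = (1 - dot p q) * (1 + dot p q - 2 * c ^+ 2).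
Proof. by move=> p1 q1 v1 pv qv; rewrite triple_sqr p1 q1 v1 pv qv; ring. Qed.

(** By [triple_sqr_isosceles], [(1 - p.q) (1 + p.q - 2 c^2)] is a nonzero square, and its first
    factor is nonnegative. The conclusions are open conditions, hence survive a small
    deformation. *)
Lemma isosceles_height_gt0 p q v c : dot p p = 1 -> dot q q = 1 ->
  dot v v = 1 -> dot p v = c -> dot q v = c -> triple p q v != 0 ->
  0 < 1 - dot p q ^+ 2 /\ 0 < 1 + dot p q - 2 * c ^+ 2.
Proof.
move=> p1 q1 v1 pv qv T0.
have /andP[k1 k2] := dot_le1 p1 q1.
have : 0 < (1 - dot p q) * (1 + dot p q - 2 * c ^+ 2).
  by rewrite -(triple_sqr_isosceles p1 q1 v1 pv qv) exprn_even_gt0.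
have k0 : 0 <= 1 - dot p q by rewrite subr_ge0.
by move=> h0; split; nra.
Qed.

End Apex.

(** * The deformation of a nondegenerate polygon *)

Section Deformation.
Variables (R : realType) (V : nat -> 'rV[R]_3) (a : R) (k : nat).
Hypothesis V1 : forall j, dot (V j) (V j) = 1.
Hypothesis Va : forall j, dot (V j) (V j.+1) = cos a.
Hypothesis a0pi : 0 < a < pi.
Hypothesis Vk2 : V k.+2 = V 0.
Hypothesis V_triple : triple (V k) (V k.+1) (V k.+2) != 0.

Let sa0 : sin a != 0. Proof. by rewrite gt_eqF ?sin_gt0_pi. Qed.

Let p := bent V a k.
Let q := bent V a 0.
Let d t := dot (p t) (q t).
Let c t := cos (a + t).
Let g0 := triple (V k) (V 0) (V k.+1) / (1 - dot (V k) (V 0) ^+ 2).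
Let h t := height2 (d t) (c t).
(** The root of [h t] having the sign of [g0], so that the apex starts at [V k.+1] and not at its
    mirror image. *)
Let g t := g0 * Num.sqrt (h t / h 0).
Let U := [set t | 0 < 1 - d t ^+ 2] `&` [set t | 0 < 1 + d t - 2 * c t ^+ 2]
  `&` ([set t | 0 < a + t] `&` [set t | 0 < pi - (a + t)]).

Definition deformed j t :=
  if (j <= k)%N then bent V a j t else apex (p t) (q t) (c t) (g t).

Let smooth_d (W : set R) : open W -> smooth_on W d.
Proof. by move=> oW; apply: smooth_on_dot => //; exact: smooth_row_bent. Qed.

Let smooth_c (W : set R) : open W -> smooth_on W c.
Proof. by move=> oW; exact: smooth_on_cos_shift. Qed.

Let smooth_cst (W : set R) (x : R) : open W -> smooth_on W (fun=> x).
Proof. by move=> oW; exact: smooth_on_cst. Qed.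

Let smooth_height (W : set R) : open W ->
  smooth_on W (fun t => 1 - d t ^+ 2) /\
  smooth_on W (fun t => 1 + d t - 2 * c t ^+ 2).
Proof.
move=> oW; have Sd := smooth_d oW; have Sc := smooth_c oW.
have S1 := smooth_cst 1 oW; have S2 := smooth_cst 2 oW.
have Sd2 : smooth_on W (fun t => d t ^+ 2) by exact: smooth_onM.
have Sc2 : smooth_on W (fun t => c t ^+ 2) by exact: smooth_onM.
split; first exact: smooth_onB.
by apply: smooth_onB => //; [exact: smooth_onD|exact: smooth_onM].
Qed.

Lemma deformation_open : open U.
Proof.
have [? ?] := smooth_height openT.
have Sa : smooth_on setT (fun t => a + t).
  by apply: smooth_onD; [exact: openT|exact/smooth_cst/openT|exact/smooth_on_id/openT].
have Spa : smooth_on setT (fun t => pi - (a + t)).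
  by apply: smooth_onB => //; [exact: openT|exact/smooth_cst/openT].
by apply: openI; apply: openI; exact: open_smooth_gt0.
Qed.

Let d0 : d 0 = dot (V k) (V 0).
Proof. by rewrite /d /p /q !bent0. Qed.

Let c0 : c 0 = cos a. Proof. by rewrite /c addr0. Qed.

Let triple_pqv : triple (V k) (V 0) (V k.+1) != 0.
Proof.
apply: contra_neq V_triple; rewrite Vk2 => e.
by rewrite -oppr0 -e /triple !dotE !crossE; ring.
Qed.

Let Vk1k : dot (V k) (V k.+1) = cos a. Proof. exact: Va. Qed.
Let Vk10 : dot (V 0) (V k.+1) = cos a. Proof. by rewrite dotC -Vk2 Va. Qed.

Lemma deformation_mem0 : U 0.
Proof.
have [? ?] := isosceles_height_gt0 (V1 k) (V1 0) (V1 k.+1) Vk1k Vk10 triple_pqv.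
by case/andP: a0pi => ? ?; split; split; rewrite /= ?d0 ?c0 ?addr0 // subr_gt0.
Qed.

Let d_gt0 t : U t -> 0 < 1 + d t.
Proof. by case=> -[/= h1 h2] _; nra. Qed.

Let h_gt0 t : U t -> 0 < h t.
Proof.
move=> Ut; have := d_gt0 Ut; case: Ut => -[/= h1 h2] _ ?.
by rewrite /h /height2 divr_gt0 // mulr_gt0.
Qed.

Let V_apex : V k.+1 = apex (V k) (V 0) (cos a) g0.
Proof.
apply: apexE => //.
by have [] := deformation_mem0; rewrite /= d0 => -[/= /gt_eqF ->].
Qed.

Let g0E : g0 ^+ 2 = h 0.
Proof.
have [[/= h1 _] _] := deformation_mem0; have k1 := d_gt0 deformation_mem0.
rewrite d0 in h1 k1.
rewrite /g0 expr_div_n (triple_sqr_isosceles _ _ _ Vk1k Vk10) //.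
by rewrite /h /height2 d0 c0; field; rewrite !gt_eqF.
Qed.

Let gE t : U t -> g t ^+ 2 = h t.
Proof.
move=> Ut; have h0 := h_gt0 deformation_mem0; have ht := h_gt0 Ut.
rewrite /g exprMn g0E sqr_sqrtr; last by rewrite ltW // divr_gt0.
by rewrite mulrC divfK // gt_eqF.
Qed.

Lemma deformed_unit j t : U t -> dot (deformed j t) (deformed j t) = 1.
Proof.
move=> Ut; rewrite /deformed; case: ifP => _; first exact: bent_unit.
apply: apex_unit; rewrite ?bent_unit ?gE //; first by rewrite gt_eqF ?d_gt0.
by case: Ut => -[/= h1 _] _; rewrite gt_eqF.
Qed.

Lemma deformed_edge j t : U t -> (j < k.+2)%N ->
  dot (deformed j t) (deformed (j.+1 %% k.+2) t) = cos (a + t).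
Proof.
move=> Ut; have d1 : 1 + d t != 0 by rewrite gt_eqF ?d_gt0.
(* Three kinds of edges: from the apex back to vertex 0, from vertex [k] to the apex, and those of
   the bent chain. *)
rewrite !ltnS leq_eqVlt => /predU1P[->|].
  rewrite modnn /deformed ltnn leq0n dotC.
  by apply: apexr; rewrite ?bent_unit.
rewrite ltnS leq_eqVlt => /predU1P[->|jk].
  rewrite modn_small // /deformed leqnn ltnn.
  by apply: apexl; rewrite ?bent_unit.
rewrite modn_small; last by rewrite !ltnS ltnW.
by rewrite /deformed jk ltnW // dot_bentS.
Qed.

Lemma deformed0 j : (j < k.+2)%N -> deformed j 0 = V j.
Proof.
rewrite ltnS leq_eqVlt => /predU1P[->|jk]; last first.
  by rewrite /deformed -ltnS jk bent0.
rewrite /deformed ltnn V_apex /p /q !bent0 c0 /g divff ?gt_eqF ?h_gt0 //.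
  by rewrite sqrtr1 mulr1.
exact: deformation_mem0.
Qed.

Lemma smooth_deformed j : smooth_row U (deformed j).
Proof.
have oU := deformation_open; rewrite /deformed; case: (j <= k)%N.
  exact: smooth_row_bent.
have [S1 S2] := smooth_height oU; have Sd := smooth_d oU; have Sc := smooth_c oU.
have Sp : smooth_row U p by exact: smooth_row_bent.
have Sq : smooth_row U q by exact: smooth_row_bent.
have Sd1 : smooth_on U (fun t => 1 + d t).
  by apply: smooth_onD => //; exact: smooth_cst.
have Sh : smooth_on U h.
  apply: smooth_onM => //; apply: smooth_onV => //; last exact: smooth_onM.
  move=> t Ut; rewrite mulf_neq0 // gt_eqF ?d_gt0 //.
  by case: Ut => -[].
apply: smooth_rowD => //; apply: smooth_rowZ => //.
- apply: smooth_onM => //; apply: smooth_onV => // t Ut.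
  by rewrite gt_eqF ?d_gt0.
- exact: smooth_rowD.
- apply: smooth_onM => //; first exact: smooth_cst.
  apply: smooth_on_sqrt => // [t Ut|].
    by rewrite divr_gt0 ?h_gt0 //; exact: deformation_mem0.
  by apply: smooth_onM => //; exact: smooth_cst.
- exact: smooth_row_cross.
Qed.

Lemma exists_deformation : exists (W : set R) (Z : nat -> R -> 'rV[R]_3),
  [/\ open W, W 0, forall j, smooth_row W (Z j),
      forall j, (j < k.+2)%N -> Z j 0 = V j &
      forall t, W t -> [/\ 0 < a + t < pi,
        forall j, dot (Z j t) (Z j t) = 1 &
        forall j, (j < k.+2)%N ->
          dot (Z j t) (Z (j.+1 %% k.+2)%N t) = cos (a + t)]].
Proof.
exists U, deformed; split.
- exact: deformation_open.
- exact: deformation_mem0.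
- exact: smooth_deformed.
- exact: deformed0.
move=> t Ut; split=> [|j|j]; [|exact: deformed_unit|exact: deformed_edge].
by case: Ut => _ [/= -> ]; rewrite subr_gt0.
Qed.

End Deformation.

(** * Nondegenerate polygons are not critical points *)

(** A vanishing triple puts [V j.+2] in the span of the independent pair [V j], [V j.+1], so the
    induction carries two consecutive vertices. *)
Lemma coplanar_of_triples (R : realType) (V : nat -> 'rV[R]_3) :
  (forall j, cross (V j) (V j.+1) != 0) ->
  (forall j, triple (V j) (V j.+1) (V j.+2) = 0) ->
  forall j, dot (cross (V 0) (V 1)) (V j) = 0.
Proof.
move=> V0 VT; set w := cross _ _.
suff H j : dot w (V j) = 0 /\ dot w (V j.+1) = 0 by move=> j; case: (H j).
elim: j => [|j [IH1 IH2]].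
  by rewrite /w ![dot (cross _ _) _]dotC dot_crossl dot_crossr.
split=> //; apply/eqP.
have /negPf c0 : dot (cross (V j) (V j.+1)) (cross (V j) (V j.+1)) != 0.
  by rewrite dot_eq0.
have : dot w (dot (cross (V j) (V j.+1)) (cross (V j) (V j.+1)) *: V j.+2) = 0.
  by rewrite cross_basis VT !(dotDr, dotZr) IH1 IH2; ring.
by move/eqP; rewrite dotZr mulf_eq0 c0.
Qed.

Lemma nondegenerate_not_critical (R : realType) (n : nat) (x : X R n) :
  (1 < n)%N -> ~ degenerate x -> ~ critical_point (@mu R n) x.
Proof.
case: n x => [//|[//|k]] x _ ndeg crit.
set n := k.+2 in x ndeg crit.
pose pB : B R n := repr x; pose P := (val pB).1; pose a := (val pB).2.
have PB : B R n (P, a).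
  by have := set_valP pB; rewrite /P /a; case: (val pB).
have P1 i : dot (row i P) (row i P) = 1 by case: PB => + _ _; apply.
have Pa i : dot (row i P) (row (ordS i) P) = cos a.
  by case: PB => _ _ /(_ i) /= <-; rewrite cos_sdist.
have a0pi : 0 < a < pi by case: PB.
have sa0 : sin a != 0 by rewrite gt_eqF ?sin_gt0_pi.
pose V j := row (inZp j : 'I_n) P.
have V1 j : dot (V j) (V j) = 1 by exact: P1.
have ordS_inZp j : ordS (inZp j : 'I_n) = inZp j.+1.
  by apply: val_inj; rewrite /= -addn1 modnDml addn1.
have Va j : dot (V j) (V j.+1) = cos a by rewrite /V -ordS_inZp Pa.
have Vper j m : (j = m %[mod n])%N -> V j = V m.
  by move=> jm; congr (row _ P); exact: val_inj.
(* Otherwise [cross (V 0) (V 1)], nonzero because [sin a != 0], would be normal to a great circle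
   containing all of [P]. *)
have [s sT] : exists s, triple (V s) (V s.+1) (V s.+2) != 0.
  apply: contrapT => noT; apply: ndeg; exists (cross (V 0) (V 1)).
    by rewrite -dot_eq0 dot_cross !V1 Va mulr1 -sin2cos2 sqrf_eq0.
  move=> i; have -> : row i P = V i by rewrite /V valZpK.
  apply: coplanar_of_triples => j.
    by rewrite -dot_eq0 dot_cross !V1 Va mulr1 -sin2cos2 sqrf_eq0.
  by apply/eqP/negPn/negP => Tj; apply: noT; exists j.
(* Renumbering by [s.+2] modulo [n = k.+2] places the independent triple at [k], [k.+1], [k.+2],
   with [V s.+1] as apex. *)
pose Vs j := V (s.+2 + j)%N.
have Vs_period j m : (j = m + n -> V j = V m)%N.
  by move=> ->; apply: Vper; rewrite modnDr.
have VsT : triple (Vs k) (Vs k.+1) (Vs k.+2) != 0.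
  have [-> -> ->] : [/\ Vs k = V s, Vs k.+1 = V s.+1 & Vs k.+2 = V s.+2].
    by split; apply: Vs_period; rewrite /n; lia.
  exact: sT.
have VsS : Vs k.+2 = Vs 0 by apply: Vs_period; rewrite addn0.
have Vs1 j : dot (Vs j) (Vs j) = 1 by exact: V1.
have Vsa j : dot (Vs j) (Vs j.+1) = cos a by rewrite /Vs addnS Va.
have [U [Z [oU U0 SZ Z0 ZU]]] := exists_deformation Vs1 Vsa a0pi VsS VsT.
(* The inverse renumbering [i - s.+2] modulo [n]: the factor [k.+1 = n - 1] stands for -1. *)
pose idx (i : 'I_n) := ((i + k.+1 * s.+2) %% n)%N.
have idx_lt i : (idx i < k.+2)%N by exact: ltn_pmod.
have idxS i : idx (ordS i) = ((idx i).+1 %% k.+2)%N.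
  by rewrite /idx /= modnDml addSn -[in RHS]addn1 modnDml addn1.
pose Q t : 'M[R]_(n, 3) * R := (\matrix_(i < n) Z (idx i) t, a + t).
have QB t : U t -> Q t \in B R n.
  move=> /ZU[at0pi Z1 Zc]; apply/mem_set; split=> //= i; rewrite !rowK //.
  by rewrite /sdist idxS Zc // cosK // in_itv /=; case/andP: at0pi => /ltW -> /ltW.
have Q0 : Q 0 = val pB.
  rewrite [RHS]surjective_pairing /Q addr0; congr (_, _).
  apply/row_matrixP => i; rewrite rowK Z0 //.
  rewrite -[in RHS](valZpK i); apply: Vper.
  by rewrite /idx modnDmr addnCA -mulSn mulnC addnC modnMDl.
pose c t : B R n := insubd pB (Q t).
have cE t : U t -> val (c t) = Q t by move=> Ut; exact: insubdK (QB t Ut).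
have Sc : smooth_curve_B c 0.
  split=> [i l|]; apply: smooth_on_near U0 => //.
    apply: (eq_smooth_on oU (f := fun t => Z (idx i) t 0 l)) => // [t Ut|].
      by rewrite cE // /Q mxE.
    exact: SZ.
  apply: (eq_smooth_on oU (f := fun t => a + t)) => // [t Ut|]; first by rewrite cE.
  by apply: smooth_onD => //; [exact: smooth_on_cst|exact: smooth_on_id].
pose gamma t := \pi_(X R n) (c t).
have Sg : smooth_curve_X gamma 0 by exists c => //; exact: filterE.
have g0 : gamma 0 = x.
  rewrite /gamma (_ : c 0 = pB) ?reprK //.
  by apply: val_inj; rewrite cE.
have d0 := crit gamma Sg g0.
have d1 : is_derive (0 : R) (1 : R) (@mu R n \o gamma) 1.
  apply: (near_eq_is_derive (f := fun t => a + t)).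
    by apply: near_open U0 _ => // t Ut; rewrite /= mu_pi cE.
  by have := is_deriveD (is_derive_cst a (0 : R) 1) (is_derive_id (0 : R) 1); rewrite add0r.
have := @derive_val _ _ _ _ _ _ _ d0; rewrite (@derive_val _ _ _ _ _ _ _ d1).
by move/eqP; rewrite oner_eq0.
Qed.

Theorem theoremA (R : realType) (n m : nat) (hn : n = (2 * m + 1)%N)
    (hn3 : (3 <= n)%N) (x : X R n) :
  critical_point (@mu R n) x <-> degenerate x.
Proof.
split=> [crit|].
  apply: contrapT => ndeg; apply: nondegenerate_not_critical ndeg crit.
  exact: ltnW.
by apply: degenerate_critical_point; rewrite hn mul2n addn1 /= odd_double.
Qed.
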